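(* Let $Q$ be an IP-polygon of maximal local index $m_Q=k\geq 2$. Then \[\mathrm{Vol}(Q)\leq 4k^3+8k^2.\] If $Q$ is an LDP-polygon, then \[\mathrm{Vol}(Q)\leq 4k^3+8k^2-2k.\] If $Q$ is an LDP-polygon and $k\geq 3$ is prime, then \[\mathrm{Vol}(Q)\leq 4k^3+4k^2-2k.\]
   Context: Fix a lattice $N\cong\mathbb{Z}^2$ with dual lattice $M=\mathrm{Hom}(N,\mathbb{Z})$ and pairing $\langle\cdot,\cdot\rangle$. A lattice polygon $Q\subset N\otimes_{\mathbb{Z}}\mathbb{Q}$ (one may equivalently work over $\mathbb{R}$) is the convex hull of finitely many points of $N$, with non-empty interior. $Q$ is an IP-polygon if the origin $\mathbf{0}$ lies in the (strict) interior of $Q$. An IP-polygon is an LDP-polygon if all its vertices are primitive lattice points (no lattice point lies strictly between the origin and a vertex). The facets of $Q$ are its edges. For a facet $F$, $\eta_F\in M$ is the unique primitive lattice point defining an outer normal of $F$, and the local index $l_F:=\langle\eta_F,F\rangle$ is the constant value of $\eta_F$ on $F$ (a positive integer). The maximal local index is $m_Q:=\max\{l_F : F \text{ a facet of } Q\}$. $\mathrm{Vol}(Q)$ is the normalised volume, i.e. twice the Euclidean area (with $N$ identified with $\mathbb{Z}^2$). *)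

(* Defs.v *)
From HB Require Import structures.
From mathcomp Require Export all_boot all_order all_algebra.
From mathcomp Require Export all_classical all_reals all_analysis.

Set Implicit Arguments.
Unset Strict Implicit.
Unset Printing Implicit Defensive.
Import Order.TTheory GRing.Theory Num.Theory.
Import numFieldNormedType.Exports.
Local Open Scope classical_set_scope.
Local Open Scope ring_scope.

(* The lattice N and its dual M are both int * int, with M acting on N through
   the standard dot product. *)

Definition lattice_pt (R : realType) (v : int * int) : R * R :=
  (v.1%:~R, v.2%:~R).

Definition pairing (R : realType) (u x : R * R) : R := u.1 * x.1 + u.2 * x.2.

Definition convex_hull (R : realType) (A : set (R * R)) : set (R * R) :=
  smallest (@convex_set R (R * R)%type) A.

(* No lattice point lies strictly between the origin and v; the choice of R is
   immaterial. *)
Definition is_primitive (R : realType) (v : int * int) : Prop :=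
  v != 0 /\
  forall (w : int * int) (t : R),
    0 < t < 1 -> lattice_pt R w <> t *: lattice_pt R v.

Definition lattice_polygon (R : realType) (Q : set (R * R)) : Prop :=
  (exists s : seq (int * int),
     Q = convex_hull (lattice_pt R @` [set` s])) /\
  Q° !=set0.

Definition IP_polygon (R : realType) (Q : set (R * R)) : Prop :=
  lattice_polygon Q /\ Q° (0, 0).

(* The face of Q on which the linear form u attains its maximum, so that u is
   an outer normal of it. *)
Definition face (R : realType) (Q : set (R * R)) (u : R * R) : set (R * R) :=
  [set x | Q x /\ forall y, Q y -> pairing u y <= pairing u x].

Definition is_vertex (R : realType) (Q : set (R * R)) (v : R * R) : Prop :=
  exists u : R * R, face Q u = [set v].

(* Two distinct points make the face one-dimensional; u <> 0 excludes Q itself. *)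
Definition is_facet (R : realType) (Q F : set (R * R)) : Prop :=
  exists u : R * R,
    [/\ u <> 0, F = face Q u & exists x y, [/\ F x, F y & x <> y]].

Definition LDP_polygon (R : realType) (Q : set (R * R)) : Prop :=
  IP_polygon Q /\
  forall v : R * R, is_vertex Q v ->
    exists2 w : int * int, v = lattice_pt R w & is_primitive R w.

Definition is_facet_normal (R : realType) (Q F : set (R * R))
    (eta : int * int) : Prop :=
  is_primitive R eta /\ F = face Q (lattice_pt R eta).

Definition is_local_index (R : realType) (Q F : set (R * R)) (l : nat) : Prop :=
  exists2 eta : int * int, is_facet_normal Q F eta &
    forall x, F x -> pairing (lattice_pt R eta) x = l%:R.

Definition is_max_local_index (R : realType) (Q : set (R * R)) (k : nat) :
    Prop :=
  (exists2 F, is_facet Q F & is_local_index Q F k) /\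
  (forall F l, is_facet Q F -> is_local_index Q F l -> (l <= k)%N).

(* Normalised volume: twice the Euclidean area. *)
Definition Vol (R : realType) (Q : set (R * R)) : \bar R :=
  (2%:E * (lebesgue_measure \x lebesgue_measure) Q)%E.

(* Main.v *)
(** Take a triangle of maximal area with vertices in Q and let g be its
    centroid; then -x/2 + 3g/2 lies in Q for every x in Q. Pick a facet
    whose normal eta satisfies <eta, g> >= 0. If eta ranges over [-h, l] on
    Q, this gives h <= 2l, where l <= k.

    In unimodular coordinates (t, x) with t = eta, facet normals that are
    positive on a lattice vector v <> 0 take an integral value >= 1 on it,
    so they cut Q off at k v. For v = (0, 1) and v = (0, -1) this traps Q in
    a trapezoid of width 2k at the level t = 0, and elementary estimates
    bound its area, except when l = k and h = 2k. In that case the level t =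
    -k contains no interior point of Q in k Z^2, which gives a trapezoid of
    width k at the level t = -k. *)

Require Import Defs.
From mathcomp Require Import ring lra zify.
Import measurable_realfun.
Import Order.TTheory GRing.Theory Num.Theory.
Import numFieldNormedType.Exports.
Set Implicit Arguments.
Unset Strict Implicit.
Unset Printing Implicit Defensive.
Local Open Scope classical_set_scope.
Local Open Scope ring_scope.

(** * Invariance of plane Lebesgue measure under unimodular maps *)

Section PlaneMeasure.
Variable R : realType.
Local Notation mu := (@lebesgue_measure R).
Local Notation mu2 := (mu \x mu)%E.
Local Notation T := (measurableTypeR R).

Lemma lebesgue_measure_shift (c : R) (A : set R) : measurable A ->
  mu [set x | A (x + c)] = mu A.
Proof.
move=> mA.
have mf : measurable_fun [set: T] (fun x : T => (x + c : T)).
  by apply: measurable_funD => //; exact: measurable_cst.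
pose f : {mfun T >-> T} := @mfun_Sub _ _ T T _ (mem_set mf).
have -> : [set x | A (x + c)] = f @^-1` A by [].
apply/esym; rewrite -[RHS]/(pushforward mu f A).
apply: lebesgue_measure_unique => //= _ [[a b]] _ <-.
rewrite /pushforward.
have -> : f @^-1` `]a, b] = `]a - c, b - c]%classic.
  by apply/seteqP; split=> x /=; rewrite !in_itv/= ltrBlDr lerBrDr.
rewrite !lebesgue_measure_itv/= !lte_fin ltrD2r; case: ifP => // _.
by rewrite -!EFinB; congr (_%:E); ring.
Qed.

(* No measurability is required: [lebesgue_measure] is the outer measure,
   defined on all sets. *)
Lemma le_lebesgue_measure (A B : set R) : A `<=` B -> (mu A <= mu B)%E.
Proof.
by move=> AB; exact: (@le_mu_ext _ (ocitv_type R) R (wlength idfun) A B AB).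
Qed.

(** The integral of a nonnegative function is a supremum over simple functions below it, hence
    monotone for arbitrary sets. This is what lets [Q] be enclosed in a trapezoid. *)
Lemma le_plane_measure (A B : set (R * R)) : A `<=` B ->
  (mu2 A <= mu2 B)%E.
Proof.
move=> AB; rewrite /product_measure1 !ge0_integralTE//.
apply: le_ereal_sup => _ [h hA <-]; exists h => // x.
apply: le_trans (hA x) _; apply: le_lebesgue_measure => y.
by rewrite /xsection/= !inE => /AB.
Qed.

(** Gives access to horizontal sections, which a shear of the first coordinate translates. *)
Lemma plane_measureE2 (A : set (T * T)) : measurable A ->
  mu2 A = (mu \x^ mu)%E A.
Proof.
move=> mA; apply: product_measure_unique => // X Y mX mY.
exact: product_measure2E.
Qed.

Lemma measurable_lin (p q r t : R) (A : set (T * T)) : measurable A ->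
  measurable [set z : T * T | A (p * z.1 + q * z.2, r * z.1 + t * z.2)].
Proof.
move=> mA.
have m (a b : R) : measurable_fun [set: T * T] (fun z : T * T => a * z.1 + b * z.2).
  by apply: measurable_funD; apply: measurable_funM.
have := measurable_fun_pair (m p q) (m r t).
by move=> /(_ measurableT A mA); rewrite setTI.
Qed.

Lemma plane_measure_shear2 (c : R) (A : set (T * T)) : measurable A ->
  mu2 [set z : T * T | A (1 * z.1 + 0 * z.2, c * z.1 + 1 * z.2)] =
  mu2 A.
Proof.
move=> mA; apply: eq_integral => x _ /=.
rewrite -[RHS](lebesgue_measure_shift (c * x)); last exact: measurable_xsection.
congr (mu _); apply/seteqP; split=> y;
  by rewrite /xsection/= !inE/= !mul1r mul0r addr0 addrC.
Qed.

Lemma plane_measure_shear1 (c : R) (A : set (T * T)) : measurable A ->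
  mu2 [set z : T * T | A (1 * z.1 + c * z.2, 0 * z.1 + 1 * z.2)] =
  mu2 A.
Proof.
move=> mA; rewrite !plane_measureE2//; last exact: measurable_lin.
apply: eq_integral => x _ /=.
rewrite -[RHS](lebesgue_measure_shift (c * x)); last exact: measurable_ysection.
congr (mu _); apply/seteqP; split=> y;
  by rewrite /ysection/= !inE/= !mul1r mul0r add0r.
Qed.

(* A matrix of determinant 1 with q != 0 is a product of three shears. *)
Lemma plane_measure_SL2 (p q r t : R) (A : set (T * T)) :
  p * t - q * r = 1 -> measurable A ->
  mu2 [set z : T * T | A (p * z.1 + q * z.2, r * z.1 + t * z.2)] =
  mu2 A.
Proof.
wlog q0 : p q r t A / q != 0 => [wlg|] d mA.
  (* For [q = 0], subtracting the first column from the second makes the upper right entry [- p],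
     which is non-zero; a unit shear undoes this. *)
  have [q0|q0] := eqVneq q 0; last exact: wlg q0 d mA.
  have p0 : p != 0.
    by apply: contra_eq_neq d => ->; rewrite q0 !mul0r subr0 eq_sym oner_eq0.
  rewrite -(wlg p (q - p) r (t - r) A) ?q0 ?sub0r ?oppr_eq0//; last by rewrite -d q0; ring.
  rewrite -[RHS](plane_measure_shear1 1); last exact: measurable_lin.
  congr (mu2 _); apply/funext => -[x y] /=; congr (A (_, _)); ring.
rewrite -[RHS](plane_measure_shear2 ((t - 1) / q))//.
rewrite -[RHS](plane_measure_shear1 q); last exact: measurable_lin.
rewrite -[RHS](plane_measure_shear2 ((p - 1) / q)); last by do 2!apply: measurable_lin.
congr (mu2 _); apply/funext => -[x y] /=; congr (A (_, _)).
  by field.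
have -> : r = (p * t - 1) / q by rewrite -d; field.
by field.
Qed.

End PlaneMeasure.

(** * Areas of trapezoids with vertical parallel sides *)

Section Trapezoid.
Variable R : realType.
Local Notation mu := (@lebesgue_measure R).
Local Notation mu2 := (mu \x mu)%E.
Local Notation T := (measurableTypeR R).

Lemma measurable_halfplane (u v c : R) :
  measurable [set z : T * T | u * z.1 + v * z.2 <= c].
Proof.
have m : measurable_fun [set: T * T] (fun z : T * T => u * z.1 + v * z.2).
  by apply: measurable_funD; apply: measurable_funM.
have /(_ measurableT `]-oo, c]%classic (measurable_itv _)) := m.
by rewrite setTI; congr measurable; apply/seteqP; split=> z /=; rewrite in_itv.
Qed.

Definition trapezoid (a b p q r s : R) : set (R * R) :=
  [set z | a <= z.1 <= b /\ p + q * z.1 <= z.2 <= r + s * z.1].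

Lemma measurable_trapezoid (a b p q r s : R) :
  measurable (trapezoid a b p q r s : set (T * T)).
Proof.
have -> : trapezoid a b p q r s =
  [set z | -1 * z.1 + 0 * z.2 <= - a] `&` [set z | 1 * z.1 + 0 * z.2 <= b] `&`
  ([set z | q * z.1 + -1 * z.2 <= - p] `&` [set z | - s * z.1 + 1 * z.2 <= r]).
  apply/seteqP; split=> z /=; rewrite /trapezoid/=; last by case=> -[] ? ? [] *; lra.
  by case=> /andP[? ?] /andP[? ?]; do !split; lra.
by do ?apply: measurableI; exact: measurable_halfplane.
Qed.

Lemma integral_affine (a b w s : R) : a < b ->
  (\int[mu]_(x in `[a, b]) (w + s * x)%:E)%E =
  (w * (b - a) + s * (b ^+ 2 - a ^+ 2) / 2)%:E.
Proof.
move=> ab; pose F x : R := w * x + s / 2 * x ^+ 2.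
have dF (x : R) : is_derive x 1 F (w + s * x).
  apply/is_derive1_caratheodory; exists (fun z => w + s / 2 * (z + x)).
  split; last by field.
    by move=> z; rewrite /F; ring.
  by apply: cvgD; [exact: cvg_cst|apply: cvgMr; apply: cvgD;
    [exact: cvg_id|exact: cvg_cst]].
have cF (x : R) : {for x, continuous F}.
  by apply: differentiable_continuous; apply/derivable1_diffP; have [] := dF x.
rewrite (@continuous_FTC2 _ (fun x => w + s * x) F)//.
- by rewrite -EFinB /F; congr (_%:E); field.
- apply: continuous_subspaceT => x.
  by apply: cvgD; [exact: cvg_cst|apply: cvgMr; exact: cvg_id].
- split; first by move=> x _; have [] := dF x.
    exact: cvg_at_right_filter (cF a).
  exact: cvg_at_left_filter (cF b).
- by move=> x _; rewrite derive1E; exact: (@derive_val _ _ _ _ _ _ _ (dF x)).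
Qed.

Lemma plane_measure_trapezoid (a b p q r s : R) : a < b ->
  p + q * a <= r + s * a -> p + q * b <= r + s * b ->
  mu2 (trapezoid a b p q r s) =
  ((r - p) * (b - a) + (s - q) * (b ^+ 2 - a ^+ 2) / 2)%:E.
Proof.
move=> ab ha hb; rewrite -integral_affine// [RHS]integral_mkcond.
apply: eq_integral => x _ /=; rewrite patchE.
case: ifPn => xab; last first.
  rewrite (_ : xsection _ _ = set0) ?measure0//.
  apply/seteqP; split=> y; rewrite /xsection/=; last by [].
  rewrite inE /= => -[/= xab' _].
  by move/negP: xab; apply; apply/mem_set; rewrite /= in_itv/= xab'.
have {xab} xab : a <= x <= b by have /set_mem := xab; rewrite /= in_itv.
rewrite (_ : xsection _ _ = `[p + q * x, r + s * x]%classic); last first.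
  apply/seteqP; split=> y; rewrite /xsection/= inE /trapezoid/= in_itv/=; first by case.
  by move=> ?; split.
rewrite lebesgue_measure_itv/= lte_fin -EFinB.
have le : p + q * x <= r + s * x.
  have /andP[xa xb] := xab.
  rewrite -subr_ge0 -(pmulr_rge0 _ (_ : 0 < b - a)) ?subr_gt0//.
  have -> : (b - a) * (r + s * x - (p + q * x)) =
    (b - x) * (r + s * a - (p + q * a)) + (x - a) * (r + s * b - (p + q * b)) by ring.
  by apply: addr_ge0; apply: mulr_ge0; rewrite subr_ge0.
case: ifPn => [_|]; first by congr (_%:E); ring.
(* The two lines meet at [x]: the section is a point and the affine length is zero. *)
rewrite -leNgt => le'; have := le_anti (introT andP (conj le le')) => e.
congr (_%:E); have : r + s * x - (p + q * x) = 0 by rewrite e subrr.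
by move=> <-; ring.
Qed.

Lemma Vol_in_trapezoid (Q : set (R * R)) (e1 e2 f1 f2 : R) (a b p q r s : R) :
  e1 * f2 - e2 * f1 = 1 -> a < b ->
  p + q * a <= r + s * a -> p + q * b <= r + s * b ->
  (forall z, Q z ->
     trapezoid a b p q r s (e1 * z.1 + e2 * z.2, f1 * z.1 + f2 * z.2)) ->
  (Vol Q <= (2 * (r - p) * (b - a) + (s - q) * (b ^+ 2 - a ^+ 2))%:E)%E.
Proof.
move=> d ab ha hb sub.
have -> : 2 * (r - p) * (b - a) + (s - q) * (b ^+ 2 - a ^+ 2) =
  2 * ((r - p) * (b - a) + (s - q) * (b ^+ 2 - a ^+ 2) / 2) by field.
rewrite /Vol EFinM lee_pmul2l// -plane_measure_trapezoid//.
rewrite -[X in (_ <= X)%E](plane_measure_SL2 d); last exact: measurable_trapezoid.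
exact: le_plane_measure.
Qed.

End Trapezoid.

(** * Supporting edges of a finite set of lattice points *)

Lemma seq_max (d : Order.disp_t) (rT : orderType d) (T : eqType) (f : T -> rT)
    (s : seq T) (x : T) :
  x \in s -> exists2 a, a \in s & forall v, v \in s -> (f v <= f a)%O.
Proof.
elim: s x => // y s IHs x _.
case: s IHs => [_|z s /(_ z (mem_head _ _)) [a ain amax]].
  by exists y => [|v]; rewrite !inE// => /eqP ->.
have [le|/ltW le] := leP (f y) (f a).
  by exists a => [|v]; rewrite inE ?ain ?orbT// => /predU1P[->|/amax].
exists y => [|v]; first exact: mem_head.
by rewrite inE => /predU1P[->//|/amax va]; exact: le_trans va le.
Qed.

Definition dotz (u v : int * int) : int := u.1 * v.1 + u.2 * v.2.

(** Discrete form of the origin being interior to the hull: no closed half-plane bounded by a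
    rational line through the origin contains [s]. *)
Definition surrounds_origin (s : seq (int * int)) :=
  forall u : int * int, u != 0 -> exists2 v, v \in s & 0 < dotz u v.

Lemma pair_neq0 (u : int * int) : (u != 0) = (u.1 != 0) || (u.2 != 0).
Proof. by case: u => a b; rewrite -negb_and. Qed.

Lemma sqr_dotz_gt0 (x : int * int) : x != 0 -> 0 < dotz x x.
Proof. by rewrite pair_neq0 /dotz -!expr2 => /orP[] ?; nia. Qed.

(* Starting from a maximiser a of x, rotate the supporting line towards y until
   it meets a second point b, found by minimising a slope. *)
Lemma supporting_edge_side (s : seq (int * int)) (x y a z : int * int) :
  (forall v, v \in s -> dotz x v <= dotz x a) -> z \in s -> dotz y a < dotz y z ->
  dotz y x = 0 -> x != 0 ->
  exists n b, [/\ b \in s, b != a, dotz n b = dotz n a, 0 < dotz n x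
    & forall v, v \in s -> dotz n v <= dotz n a].
Proof.
move=> amax zin yaz yx x0.
(* Change of [x] per unit of [y] from [a] to [v]: nonpositive on the filtered points, and maximal
   where the rotating line first hits. *)
pose f v : rat := (dotz x v - dotz x a)%:~R / (dotz y v - dotz y a)%:~R.
have [|b] := @seq_max _ _ _ f [seq v <- s | dotz y a < dotz y v] z.
  by rewrite mem_filter yaz.
rewrite mem_filter => /andP[yab bin] bmax.
pose P := dotz y b - dotz y a; pose N := dotz x a - dotz x b.
have P0 : 0 < P by rewrite subr_gt0.
have N0 : 0 <= N by rewrite subr_ge0 amax.
(* From [a] to [b], [y] rises by [P] and [x] falls by [N], so [P x + N y] is constant along the
   edge. *)
pose n : int * int := (P * x.1 + N * y.1, P * x.2 + N * y.2).
have nE v : dotz n v = P * dotz x v + N * dotz y v by rewrite /n /dotz/=; ring.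
exists n, b; split => //.
- by apply: contraTneq yab => ->; rewrite ltxx.
- by rewrite !nE /P /N; ring.
- by rewrite nE yx mulr0 addr0 mulr_gt0// sqr_dotz_gt0.
move=> v vin; rewrite !nE.
have xv := amax _ vin.
(* Behind [a] neither [x] nor [y] exceeds its value at [a]; ahead of [a] the bound is the maximality
   of [f b]. *)
have [yva|yav] := leP (dotz y v) (dotz y a); first by nia.
have := bmax v; rewrite mem_filter yav vin => /(_ isT).
rewrite /f ler_pdivrMr ?ltr0z ?subr_gt0// mulrAC ler_pdivlMr ?ltr0z ?subr_gt0//.
by rewrite -!rmorphM/= ler_int /P /N; nia.
Qed.

(** With [y] the quarter turn of [x], the line is rotated about a maximiser of [x] towards whichever
    side contains points of [s]. *)
Lemma supporting_edge (s : seq (int * int)) (x : int * int) :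
  surrounds_origin s -> x != 0 ->
  exists n a b, [/\ a \in s, b \in s, b != a, dotz n b = dotz n a & 0 < dotz n x]
    /\ forall v, v \in s -> dotz n v <= dotz n a.
Proof.
move=> sur x0.
have [z0 z0in _] := sur _ x0.
have [a ain amax] := @seq_max _ _ _ (dotz x) s z0 z0in.
pose y : int * int := (- x.2, x.1).
have y0 : y != 0 by move: x0; rewrite !pair_neq0/= oppr_eq0 orbC.
have ny0 : ((x.2, - x.1) : int * int) != 0 by move: x0; rewrite !pair_neq0/= oppr_eq0 orbC.
have yN v : dotz (x.2, - x.1) v = - dotz y v by rewrite /dotz/=; ring.
have [yz|/hasPn yle] := boolP (has (fun v => dotz y a < dotz y v) s).
  have [z zin yaz] := hasP yz.
  have [|n [b [? ? ? ? ?]]] := supporting_edge_side amax zin yaz _ x0.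
    by rewrite /dotz/=; ring.
  by exists n, a, b.
have [yz|/hasPn yge] := boolP (has (fun v => dotz y v < dotz y a) s).
  have [z zin yaz] := hasP yz.
  have [||n [b [? ? ? ? ?]]] := @supporting_edge_side s x (x.2, - x.1) a z amax zin _ _ x0.
  - by rewrite !yN ltrN2.
  - by rewrite /dotz/=; ring.
  by exists n, a, b.
(* With no point on either side, [y] would be constant on [s], yet it takes both signs there. *)
have [v vin] := sur _ y0; have [w win] := sur _ ny0; rewrite yN.
by have := yle _ vin; have := yge _ win; lia.
Qed.

Lemma primitive_supporting_edge (s : seq (int * int)) (x : int * int) :
  surrounds_origin s -> x != 0 ->
  exists n a b, [/\ a \in s, b \in s, b != a, dotz n b = dotz n a & 0 < dotz n x]
    /\ [/\ coprimez n.1 n.2, 0 < dotz n a & forall v, v \in s -> dotz n v <= dotz n a].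
Proof.
move=> sur x0; have [n [a [b [[ain bin ba nab nx] nmax]]]] := supporting_edge sur x0.
have n0 : n != 0 by apply: contraTneq nx => ->; rewrite /dotz/= !mul0r ltxx.
pose g := gcdz n.1 n.2.
have g0 : 0 < g by rewrite lt_neqAle eq_sym gcdz_eq0 negb_and -pair_neq0 n0.
pose e := ((n.1 %/ g)%Z, (n.2 %/ g)%Z).
have nE v : dotz n v = g * dotz e v.
  rewrite /dotz /e/= mulrDr !mulrA ![g * _]mulrC !divzK//; [exact: dvdz_gcdr|exact: dvdz_gcdl].
exists e, a, b.
have e0 : e != 0.
  by apply: contraTneq nx => e0; rewrite nE e0 /dotz/= !mul0r mulr0 ltxx.
have emax v : v \in s -> dotz e v <= dotz e a.
  by move=> /nmax; rewrite !nE ler_pM2l.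
split; split => //.
- by apply: (mulfI (lt0r_neq0 g0)); rewrite -!nE.
- by rewrite -(pmulr_rgt0 _ g0) -nE.
- rewrite /coprimez; apply/eqP; apply: (mulfI (lt0r_neq0 g0)).
  have := mulz_gcdr g e.1 e.2; rewrite abszE gtr0_norm// => ->.
  rewrite /e/= ![g * _]mulrC !divzK; [by rewrite mul1r|exact: dvdz_gcdr|exact: dvdz_gcdl].
- by have [v /emax + /lt_le_trans] := sur _ e0; move=> + h; exact: h.
Qed.

(** * Triangles of maximal area and the resulting asymmetry bound *)

(** Twice the signed area of the triangle [a b c]. *)
Definition orient (a b c : int * int) : int :=
  (b.1 - a.1) * (c.2 - a.2) - (b.2 - a.2) * (c.1 - a.1).

Lemma orient_gt0 (s : seq (int * int)) : surrounds_origin s ->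
  exists a b c, [/\ a \in s, b \in s, c \in s & 0 < orient a b c].
Proof.
move=> sur.
have [a ain a0] := sur (1, 0) isT.
have [b bin ba] : exists2 b, b \in s & b != a.
  have [b bin b0] := sur (- a.1, - a.2) ltac:(by move: a0; rewrite /dotz pair_neq0/=; lia).
  exists b => //; apply: contraTneq b0 => ->; rewrite /dotz/= -leNgt; nia.
pose u := (- (b.2 - a.2), b.1 - a.1).
have u0 : u != 0.
  rewrite pair_neq0/= oppr_eq0 !subr_eq0; apply: contraNT ba.
  rewrite negb_or !negbK => /andP[/eqP e2 /eqP e1].
  by rewrite -pair_eqE/= /pair_eq/= e1 e2 !eqxx.
pose u' := (b.2 - a.2, - (b.1 - a.1)).
have u'0 : u' != 0 by move: u0; rewrite !pair_neq0/= !oppr_eq0.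
have [c cin c0] := sur _ u0; have [d din d0] := sur _ u'0.
(* [u] is constant on the line [a b]. If both triangles failed, that constant would be both positive
   and negative. *)
have [|h1] := ltP 0 (orient a b c); first by exists a, b, c.
have [|h2] := ltP 0 (orient b a d); first by exists b, a, d.
by move: h1 h2 c0 d0; rewrite /orient /dotz/u/u'/=; lia.
Qed.

(* G is three times the centroid of a triangle of maximal area with vertices in
   s, so barycentric coordinates of points of s are at most 1. *)
Lemma centroid_asymmetry (s : seq (int * int)) : surrounds_origin s ->
  exists G : int * int, forall n l, (forall v, v \in s -> dotz n v <= l) ->
    forall z, z \in s -> dotz n G - dotz n z <= 2 * l.
Proof.
move=> sur; have [a0 [b0 [c0 [a0in b0in c0in pos]]]] := orient_gt0 sur.
pose f (t : (int * int) * (int * int) * (int * int)) := orient t.1.1 t.1.2 t.2.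
pose s3 := [seq (x, y) | x <- [seq (x, y) | x <- s, y <- s], y <- s].
have in3 a b c : (a, b, c) \in s3 = [&& a \in s, b \in s & c \in s].
  apply/allpairsP/and3P => [|[ain bin cin]].
    by move=> [[[x y] z] /= [/allpairsP[[x' y'] /= [? ? [-> ->]]] ? [-> -> ->]]].
  by exists ((a, b), c); split => //=; apply/allpairsP; exists (a, b).
have [|[[a b] c]] := @seq_max _ _ _ f s3 (a0, b0, c0); first by rewrite in3 a0in b0in.
rewrite in3 => /and3P[ain bin cin] fmax.
exists (a.1 + b.1 + c.1, a.2 + b.2 + c.2) => n l nl z zin.
have D0 : 0 < orient a b c.
  by apply: lt_le_trans pos _; apply: (fmax (a0, b0, c0)); rewrite in3 a0in b0in.
have h1 : orient z b c <= orient a b c by apply: (fmax (z, b, c)); rewrite in3 zin bin.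
have h2 : orient a z c <= orient a b c by apply: (fmax (a, z, c)); rewrite in3 zin ain.
have h3 : orient a b z <= orient a b c by apply: (fmax (a, b, z)); rewrite in3 ain bin.
rewrite -(ler_pM2l D0).
(* [G - z] combines the vertices with weights one minus the barycentric coordinates of [z]; these
   are nonnegative and sum to 2. *)
have -> : orient a b c * (dotz n (a.1 + b.1 + c.1, a.2 + b.2 + c.2) - dotz n z) =
   (orient a b c - orient z b c) * dotz n a + (orient a b c - orient a z c) * dotz n b
   + (orient a b c - orient a b z) * dotz n c by rewrite /orient /dotz/=; ring.
have -> : orient a b c * (2 * l) =
   (orient a b c - orient z b c) * l + (orient a b c - orient a z c) * l
   + (orient a b c - orient a b z) * l by rewrite /orient /=; ring.
by rewrite !lerD// ler_wpM2l ?subr_ge0 ?nl.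
Qed.

(** * From the convex hull to its generators, and facet normals *)

Section LatticeHull.
Variables (R : realType) (s : seq (int * int)).
Local Notation Q := (convex_hull (lattice_pt R @` [set` s])).

Lemma pairing_lattice_pt (u v : int * int) :
  pairing (lattice_pt R u) (lattice_pt R v) = (dotz u v)%:~R.
Proof. by rewrite /pairing /dotz /= rmorphD !rmorphM. Qed.

Lemma hull_pairing_le (u : R * R) (c : R) :
  (forall v, v \in s -> pairing u (lattice_pt R v) <= c) ->
  forall z, Q z -> pairing u z <= c.
Proof.
move=> us z /(_ [set x | pairing u x <= c]); apply; split => [|_ [v vs <-]]; last exact: us.
move=> x y t; rewrite !inE /= => ux uy.
have [t0 t1] : 0 <= t%:num /\ t%:num <= 1 by [].
change (u.1 * (t%:num * x.1 + (1 - t%:num) * y.1) +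
  u.2 * (t%:num * x.2 + (1 - t%:num) * y.2) <= c).
rewrite /pairing in ux uy.
have : (1 - t%:num) * (u.1 * y.1 + u.2 * y.2) <= (1 - t%:num) * c.
  by rewrite ler_wpM2l// subr_ge0.
have : t%:num * (u.1 * x.1 + u.2 * x.2) <= t%:num * c by rewrite ler_wpM2l.
lra.
Qed.

Lemma lattice_pt_in_hull v : v \in s -> Q (lattice_pt R v).
Proof. by move=> vs; apply: sub_gen_smallest; exists v. Qed.

(** If [u] were nonpositive on [s], it would be so on the hull, which contains a small positive
    multiple of [u]. *)
Lemma hull_surrounds_origin : Q° (0, 0) -> surrounds_origin s.
Proof.
move=> /nbhs_ballP[e /= e0 eQ] u u0.
have [/hasP[v]|/hasPn le0] := boolP (has (fun v => 0 < dotz u v) s); first by exists v.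
(* [M] strictly exceeds both coordinates in absolute value, so [(e / M) u] lies in the open ball of
   radius [e]. *)
pose M : R := 1 + `|u.1%:~R| + `|u.2%:~R|.
have M0 : 0 < M by rewrite /M -addrA ltr_pwDl.
pose t := e / M.
have t0 : 0 < t by rewrite divr_gt0.
have Qt : Q (t * u.1%:~R, t * u.2%:~R).
  have tM : t * M = e by rewrite /t divfK// gt_eqF.
  by apply: eQ; split; rewrite /ball/= sub0r normrN normrM (gtr0_norm t0) -tM ltr_pM2l// /M;
    have := normr_ge0 (u.1%:~R : R); have := normr_ge0 (u.2%:~R : R); lra.
have := hull_pairing_le (u := lattice_pt R u) (c := 0) _ Qt.
have /[swap]/[apply] : forall v, v \in s -> pairing (lattice_pt R u) (lattice_pt R v) <= 0.
  by move=> v /le0; rewrite pairing_lattice_pt lerz0 -leNgt.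
have -> : pairing (lattice_pt R u) (t * u.1%:~R, t * u.2%:~R) = t * (dotz u u)%:~R.
  by rewrite -pairing_lattice_pt /pairing /=; ring.
by rewrite pmulr_rle0// lerz0 leNgt sqr_dotz_gt0.
Qed.

(** By Bezout, a lattice point [t n] forces [t] to be an integer. *)
Lemma coprime_is_primitive (n : int * int) : coprimez n.1 n.2 -> is_primitive R n.
Proof.
move=> cop; have [a [b ab]] := Bezoutz n.1 n.2; rewrite (eqP cop) in ab.
split; first by apply: contraTneq cop => ->.
move=> w t /andP[t0 t1] [e1 e2].
have tE : t = (a * w.1 + b * w.2)%:~R.
  have w1 : w.1%:~R = t * n.1%:~R := e1.
  have w2 : w.2%:~R = t * n.2%:~R := e2.
  have : t * (a * n.1 + b * n.2)%:~R = (a * w.1 + b * w.2)%:~R.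
    by rewrite !rmorphD !rmorphM/= w1 w2; ring.
  by rewrite ab mulr1.
by move: t0 t1; rewrite tE ltr0z ltrz1; lia.
Qed.

(** Two distinct maximisers of a primitive normal make its face a facet of the hull, whose local
    index is the maximum, hence at most [k]. *)
Lemma facet_normal_exists (k : nat) (x : int * int) :
  Q° (0, 0) -> is_max_local_index Q k -> x != 0 ->
  exists n, [/\ coprimez n.1 n.2, 0 < dotz n x & exists l : int,
    [/\ 0 < l <= k, (forall v, v \in s -> dotz n v <= l) &
        exists2 v, v \in s & dotz n v = l]].
Proof.
move=> Q0 [_ kmax] x0; have sur := hull_surrounds_origin Q0.
have [n [a [b [[ain bin ba nba nx] [cop na0 nmax]]]]] := primitive_supporting_edge sur x0.
have Qn z : Q z -> pairing (lattice_pt R n) z <= (dotz n a)%:~R.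
  by apply: hull_pairing_le => v /nmax; rewrite pairing_lattice_pt ler_int.
pose F := face Q (lattice_pt R n).
have FF v : v \in s -> dotz n v = dotz n a -> F (lattice_pt R v).
  move=> vin nv; split; first exact: lattice_pt_in_hull.
  by move=> y /Qn; rewrite pairing_lattice_pt nv.
have prim := coprime_is_primitive cop.
have inj u v : lattice_pt R u = lattice_pt R v -> u = v.
  by case: u v => [? ?] [? ?] [] /intr_inj -> /intr_inj ->.
have facet : is_facet Q F.
  exists (lattice_pt R n); split => //.
    by move=> /(inj n (0, 0)) n0; case: prim => /eqP.
  exists (lattice_pt R b), (lattice_pt R a); split; [exact: FF|exact: FF|].
  by move=> /inj e; rewrite e eqxx in ba.
have li : is_local_index Q F `|dotz n a|%N.
  exists n => // z [Qz zmax]; apply/le_anti.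
  rewrite pmulrn abszE gtr0_norm//.
  by rewrite Qn//= -pairing_lattice_pt zmax//; exact: lattice_pt_in_hull.
exists n; split => //; exists (dotz n a); split => //; last by exists a.
by have := kmax _ _ facet li; lia.
Qed.

End LatticeHull.

(** * Strips cut out by blocking functionals *)

Section Strips.
Variable R : realType.

(* No point k v with v != 0 integral is interior to K, as certified by integral
   functionals bounded by k on K. *)
Definition blocks_lattice (k : nat) (K : set (R * R)) :=
  forall v1 v2 : int, (v1 != 0) || (v2 != 0) ->
  exists b a : int, 1 <= b * v1 + a * v2 /\
    forall z, K z -> b%:~R * z.1 + a%:~R * z.2 <= k%:R.

(** The functionals blocking [(0, 1)] and [(0, -1)] have second coefficient at least 1 in absolute
    value; dividing by it leaves a constant term of size at most [k]. *)
Lemma strip_at_origin (k : nat) (K : set (R * R)) : blocks_lattice k K ->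
  exists q s : R, forall z, K z ->
    - k%:R + q * z.1 <= z.2 <= k%:R + s * z.1.
Proof.
move=> bK; have [b [a [ba1 Kr]]] := bK 0 1 isT; have [d [c [dc1 Kl]]] := bK 0 (-1) isT.
have a1 : 1 <= a%:~R :> R by rewrite ler1z; lia.
have c1 : c%:~R <= -1 :> R by rewrite (_ : -1 = (-1)%:~R)// ler_int; lia.
have k0 : 0 <= k%:R :> R by [].
exists (- d%:~R / c%:~R), (- b%:~R / a%:~R) => z Kz; apply/andP; split.
  have c0 : c%:~R != 0 :> R by rewrite lt_eqF//; lra.
  have -> : - d%:~R / c%:~R * z.1 = (- d%:~R * z.1) / c%:~R by field.
  rewrite -(ler_nM2r (_ : c%:~R < 0)); last lra.
  by rewrite mulrDl divfK//; have := Kl _ Kz; nra.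
have a0 : a%:~R != 0 :> R by rewrite gt_eqF//; lra.
have -> : - b%:~R / a%:~R * z.1 = (- b%:~R * z.1) / a%:~R by field.
rewrite -(ler_pM2r (_ : 0 < a%:~R)); last lra.
by rewrite mulrDl divfK//; have := Kr _ Kz; nra.
Qed.

(** The functional blocking [(-1, m)] is at least [k] at [(- k, m k)], so a line through that point
    bounds [K]; the sign of [a] tells the side. *)
Lemma half_strip_below (k : nat) (K : set (R * R)) (y : R) (m : int) :
  (0 < k)%N -> blocks_lattice k K -> K (- (2 * k%:R), y) ->
  (exists q : R, forall z, K z -> m%:~R * k%:R + q * (z.1 + k%:R) <= z.2) \/
  (exists s : R, forall z, K z -> z.2 <= m%:~R * k%:R + s * (z.1 + k%:R)).
Proof.
move=> k0 bK Ky; have [b [a [ba1 Kba]]] := bK (-1) m isT.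
have k1 : 0 < k%:R :> R by rewrite ltr0n.
have ba1' : 1 <= - b%:~R + m%:~R * a%:~R :> R.
  have := ba1; rewrite -(ler_int R) rmorphD !rmorphM/= rmorphN rmorph1; lra.
have h : k%:R <= k%:R * (- b%:~R + m%:~R * a%:~R) :> R by rewrite ler_pMr.
have [a0|a0|a0] := ltgtP a 0.
- left; exists (- b%:~R / a%:~R) => z Kz.
  have a0' : a%:~R < 0 :> R by rewrite ltrz0.
  have an0 : a%:~R != 0 :> R by rewrite lt_eqF.
  have -> : - b%:~R / a%:~R * (z.1 + k%:R) = (- b%:~R * (z.1 + k%:R)) / a%:~R by field.
  rewrite -(ler_nM2r a0') mulrDl divfK//; have := Kba _ Kz; lra.
- right; exists (- b%:~R / a%:~R) => z Kz.
  have a0' : 0 < a%:~R :> R by rewrite ltr0z.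
  have an0 : a%:~R != 0 :> R by rewrite gt_eqF.
  have -> : - b%:~R / a%:~R * (z.1 + k%:R) = (- b%:~R * (z.1 + k%:R)) / a%:~R by field.
  rewrite -(ler_pM2r a0') mulrDl divfK//; have := Kba _ Kz; lra.
(* Here [b <= -1], and the functional would be at least [2 k] at the point of level [- 2 k]. *)
- have := Kba _ Ky; rewrite a0 /= mul0r addr0.
  by move: h; rewrite a0 mulr0 addr0; lra.
Qed.

(** The midpoint [(- k, y / 2)] of the two given points decides on which side of [K] each line
    through [(- k, m k)] lies. *)
Lemma strip_below (k : nat) (K : set (R * R)) (y : R) :
  (0 < k)%N -> blocks_lattice k K -> K (- (2 * k%:R), y) -> K (0, 0) ->
  exists (m : int) (q s : R), forall z, K z ->
    m%:~R * k%:R + q * (z.1 + k%:R) <= z.2 <= (m + 1)%:~R * k%:R + s * (z.1 + k%:R).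
Proof.
move=> k0 bK Ky K0.
have k1 : 0 < k%:R :> R by rewrite ltr0n.
have half := half_strip_below _ k0 bK Ky.
have midl m q : (forall z, K z -> m%:~R * k%:R + q * (z.1 + k%:R) <= z.2) ->
  m%:~R <= y / 2 / k%:R :> R.
  by move=> h; rewrite ler_pdivlMr//; have := h _ Ky; have := h _ K0; rewrite /=; lra.
have midr m q : (forall z, K z -> z.2 <= m%:~R * k%:R + q * (z.1 + k%:R)) ->
  y / 2 / k%:R <= m%:~R :> R.
  by move=> h; rewrite ler_pdivrMr//; have := h _ Ky; have := h _ K0; rewrite /=; lra.
set t := y / 2 / k%:R in midl midr.
pose m := Num.floor t.
have mt : m%:~R <= t by exact: floor_le_tmp.
have tm : t < (m + 1)%:~R by exact: floorD1_gt.
(* Since [t < m + 1], the line at [m + 1] lies above [K]. *)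
have [[q /midl]|[s Hs]] := half (m + 1); first by move=> h; exfalso; lra.
have [[q Hq]|[s' Hs']] := half m.
  by exists m, q, s => z Kz; rewrite Hq// Hs.
(* The line at [m] is also an upper one, so the strip moves down by one: [m - 1 < t] makes the line
   at [m - 1] a lower one. *)
have [[q Hq]|[s'' /midr]] := half (m - 1); last first.
  by move=> h; exfalso; move: h; rewrite rmorphB/=; lra.
by exists (m - 1), q, s' => z Kz; rewrite Hq// subrK Hs'.
Qed.

End Strips.

(** * Numerical estimates for trapezoid areas *)

Section Numerics.
Variable R : realFieldType.
Implicit Types h k l c : R.

(** Here [c] is the difference of slopes, and [h c <= 2 k] says that the width at level [- h] is
    nonnegative. Substituting it, [h] times the left side is at most [2 k (l + h)^2]. *)
Lemma trapezoid_bound_flat h k l c :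
  1 <= h -> h <= l -> l <= k -> 2 <= k -> h * c <= 2 * k ->
  4 * k * (l + h) + c * (l ^+ 2 - h ^+ 2) <= 4 * k ^+ 3 + 4 * k ^+ 2 - 2 * k.
Proof.
move=> h1 hl lk k2 hc.
have h0 : 0 < h by lra.
rewrite -(ler_pM2l h0).
have e1 : (h * c) * (l ^+ 2 - h ^+ 2) <= 2 * k * (l ^+ 2 - h ^+ 2).
  by rewrite ler_wpM2r// subr_ge0 ler_sqr ?nnegrE; lra.
have e2 : (l + h) ^+ 2 <= (k + h) ^+ 2 by rewrite ler_sqr ?nnegrE; lra.
have e3 : k ^+ 2 + h ^+ 2 + h <= 2 * k ^+ 2 * h.
  have : 0 <= h * (k ^+ 2 - h - 1) by apply: mulr_ge0; nra.
  have : 0 <= k ^+ 2 * (h - 1) by apply: mulr_ge0; nra.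
  by nra.
have e4 : 0 <= 2 * k * (h * (2 * k ^+ 2 + 2 * k - 1) - (k + h) ^+ 2).
  by rewrite mulr_ge0 ?subr_ge0//; nra.
have e5 : 2 * k * (l + h) ^+ 2 <= 2 * k * (k + h) ^+ 2 by rewrite ler_wpM2l//; lra.
nra.
Qed.

(** The mirror estimate: now [c] multiplies a nonpositive term and is bounded below by the width at
    level [l]. *)
Lemma trapezoid_bound_steep h k l c :
  1 <= l -> l <= h -> 0 <= k -> - (2 * k) <= l * c ->
  l * (4 * k * (l + h) + c * (l ^+ 2 - h ^+ 2)) <= 2 * k * (l + h) ^+ 2.
Proof.
move=> l1 lh k0 lc.
have : 0 <= (l * c + 2 * k) * (h ^+ 2 - l ^+ 2).
  by rewrite mulr_ge0 ?subr_ge0 ?ler_sqr ?nnegrE; lra.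
nra.
Qed.

End Numerics.

(** For [l < k] the bound [9 l^2] suffices; for [l = k] it is [(3 k - 1)^2]. At [h = 2 k] the value
    [9 k^2] breaks the first inequality for [k = 2] and the second for [k = 3]. *)
Lemma steep_numerics (h k l : int) : 1 <= l -> l <= k -> 2 <= k -> l < h ->
  h <= 2 * l -> ~ (l = k /\ h = 2 * k) ->
  (l + h) ^+ 2 <= l * (2 * k ^+ 2 + 4 * k - 1) /\
  (3 <= k -> (l + h) ^+ 2 <= l * (2 * k ^+ 2 + 2 * k - 1)).
Proof.
move=> l1 lk k2 lh hl ne.
have [lk'|kl] := leP l (k - 1).
  have e : (l + h) ^+ 2 <= l * (9 * l) by nia.
  have e2 : 9 * l <= 2 * k ^+ 2 + 2 * k - 1 by nia.
  have e3 : l * (9 * l) <= l * (2 * k ^+ 2 + 2 * k - 1) by rewrite ler_wpM2l//; lia.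
  by split=> [|_]; nia.
have {lk kl} lk : l = k by lia.
subst l; have h1 : h <= 2 * k - 1 by lia.
have e : (k + h) ^+ 2 <= (3 * k - 1) ^+ 2 by nia.
by split => [|k3]; nia.
Qed.

(** * The area bound in unimodular coordinates *)

Section Bounds.
Variable R : realType.

Definition lin_map (e1 e2 f1 f2 : R) (z : R * R) : R * R :=
  (e1 * z.1 + e2 * z.2, f1 * z.1 + f2 * z.2).

Lemma Vol_bound_coordinates (Q : set (R * R)) (e1 e2 f1 f2 : R) (k : nat)
    (l h : int) (y y' : R) (K := lin_map e1 e2 f1 f2 @` Q) :
  e1 * f2 - e2 * f1 = 1 -> blocks_lattice k K -> K (0, 0) ->
  (forall z, K z -> - h%:~R <= z.1 <= l%:~R) ->
  K (l%:~R, y) -> K (- h%:~R, y') ->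
  1 <= l -> l <= k -> 1 <= h -> h <= 2 * l -> (2 <= k)%N ->
  exists V : R, [/\ (Vol Q <= V%:E)%E,
    V <= 4 * k%:R ^+ 3 + 8 * k%:R ^+ 2 - 2 * k%:R &
    (3 <= k)%N -> V <= 4 * k%:R ^+ 3 + 4 * k%:R ^+ 2 - 2 * k%:R].
Proof.
move=> det bK K0 Klh Kl Kh l1 lk h1 hl k2.
have k2Z : 2 <= k%:Z by [].
have k2R : 2 <= k%:R :> R by rewrite ler_nat.
have l1R : 1 <= l%:~R :> R by rewrite ler1z.
have h1R : 1 <= h%:~R :> R by rewrite ler1z.
have lkR : l%:~R <= k%:R :> R by rewrite pmulrn ler_int.
have lh0 : - h%:~R < l%:~R :> R by lra.
have K_in z : Q z -> K (lin_map e1 e2 f1 f2 z) by exists z.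
have [[lk' h2k]|ne] := pselect (l = k /\ h = 2 * k%:Z).
  have lE : l%:~R = k%:R :> R by rewrite lk' pmulrn.
  have hE : h%:~R = 2 * k%:R :> R by rewrite h2k rmorphM/= pmulrn.
  rewrite hE in Kh Klh lh0; rewrite lE in Kl Klh lh0.
  have [|m [q [s Kqs]]] := strip_below _ bK Kh K0; first lia.
  (* The strip has width [k] at level [- k] and nonnegative width at level [- 2 k]. *)
  have sq : s - q <= 1.
    have /andP[] := Kqs _ Kh; rewrite rmorphD/= => ? ?.
    have : 0 <= k%:R * (1 - (s - q)) by lra.
    by rewrite pmulr_rge0 ?subr_ge0//; lra.
  have ends z : K z -> m%:~R * k%:R + q * k%:R + q * z.1 <=
     (m + 1)%:~R * k%:R + s * k%:R + s * z.1.
    by move=> /Kqs /andP[]; lra.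
  (* This volume is [6 k^2 + 3 k^2 (s - q)], at most [9 k^2]. *)
  have VQ := @Vol_in_trapezoid R Q _ _ _ _ _ _ _ _ _ _ det lh0 (ends _ Kh) (ends _ Kl).
  eexists; split; first apply: VQ => z Qz.
  - split; first exact: Klh _ (K_in _ Qz).
    by have /andP[/= ? ?] := Kqs _ (K_in _ Qz); apply/andP; split=> /=; lra.
  - rewrite rmorphD/=; have : k%:R ^+ 2 * (s - q) <= k%:R ^+ 2 * 1 by rewrite ler_wpM2l.
    by nra.
  move=> k3; have k3R : 3 <= k%:R :> R by rewrite (ler_nat _ 3).
  rewrite rmorphD/=; have : k%:R ^+ 2 * (s - q) <= k%:R ^+ 2 * 1 by rewrite ler_wpM2l.
  by nra.
have [q [s Kqs]] := strip_at_origin bK.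
have ends z : K z -> - k%:R + q * z.1 <= k%:R + s * z.1 by move=> /Kqs /andP[]; lra.
have cl := ends _ Kl; have ch := ends _ Kh; rewrite /= in cl ch.
have VQ := @Vol_in_trapezoid R Q _ _ _ _ _ _ _ _ _ _ det lh0 ch cl.
have [hle|lth] := leP h l.
  have hlR : h%:~R <= l%:~R :> R by rewrite ler_int.
  have bound := @trapezoid_bound_flat R h%:~R k%:R l%:~R (s - q) h1R hlR lkR k2R.
  eexists; split; first by apply: VQ => z Qz; split;
    [exact: Klh _ (K_in _ Qz)|exact: Kqs _ (K_in _ Qz)].
    by have := sqr_ge0 (k%:R : R); lra.
  by lra.
have lhR : l%:~R <= h%:~R :> R by rewrite ler_int ltW.
have bound := @trapezoid_bound_steep R h%:~R k%:R l%:~R (s - q) l1R lhR.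
(* [N] will be [2 k^2 + 4 k - 1] or [2 k^2 + 2 k - 1], the target bounds divided by [2 k]. *)
have scale (N : int) : (l + h) ^+ 2 <= l * N ->
    4 * k%:R * (l%:~R + h%:~R) + (s - q) * (l%:~R ^+ 2 - h%:~R ^+ 2)
    <= 2 * k%:R * N%:~R :> R.
  rewrite -(ler_int R) !(rmorphM, rmorphXn, rmorphD)/= => lhN.
  rewrite -(ler_pM2l (_ : 0 < l%:~R)); last lra.
  apply: le_trans (bound _ _) _; [by lra|by lra|].
  have : 2 * k%:R * (l%:~R + h%:~R) ^+ 2 <= 2 * k%:R * (l%:~R * N%:~R) :> R.
    by rewrite ler_wpM2l.
  by lra.
have [|num num3] := @steep_numerics h k l l1 lk k2Z lth hl; first by move=> [? ?]; apply: ne.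
eexists; split; first by apply: VQ => z Qz; split;
    [exact: Klh _ (K_in _ Qz)|exact: Kqs _ (K_in _ Qz)].
  by have := scale _ num; rewrite !(rmorphM, rmorphXn, rmorphD, rmorphN)/= -!pmulrn; lra.
move=> k3; have := scale _ (num3 k3).
by rewrite !(rmorphM, rmorphXn, rmorphD, rmorphN)/= -!pmulrn; lra.
Qed.

End Bounds.

(** * Choice of coordinates and conclusion *)

Lemma Vol_bound (R : realType) (Q : set (R * R)) (k : nat) :
  IP_polygon Q -> is_max_local_index Q k -> (2 <= k)%N ->
  exists V : R, [/\ (Vol Q <= V%:E)%E,
    V <= 4 * k%:R ^+ 3 + 8 * k%:R ^+ 2 - 2 * k%:R &
    (3 <= k)%N -> V <= 4 * k%:R ^+ 3 + 4 * k%:R ^+ 2 - 2 * k%:R].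
Proof.
move=> [[[s ->] _] Q0] kmax k2; set Q' := convex_hull _.
have sur := hull_surrounds_origin Q0.
have [G HG] := centroid_asymmetry sur.
have [n [cop nG [l [/andP[l0 lk] nl [v0 v0in nv0]]]]] : exists n,
    [/\ coprimez n.1 n.2, 0 <= dotz n G & exists l : int,
    [/\ 0 < l <= k, (forall v, v \in s -> dotz n v <= l) &
        exists2 v, v \in s & dotz n v = l]].
  have [->|G0] := eqVneq G 0.
    have [n [cop _ ?]] := facet_normal_exists Q0 kmax (isT : ((1, 0) : int * int) != 0).
    by exists n; split => //; rewrite /dotz/= !mulr0.
  have [n [cop /ltW nG ?]] := facet_normal_exists Q0 kmax G0.
  by exists n; split.
have [z zin zmin] := @seq_max _ _ _ (fun v => - dotz n v) s v0 v0in.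
pose h := - dotz n z.
have h0 : 0 < h.
  have n0 : ((- n.1, - n.2) : int * int) != 0.
    by rewrite pair_neq0/= !oppr_eq0 -pair_neq0; apply: contraTneq cop => ->.
  have [v vin nv] := sur _ n0; have := zmin _ vin; rewrite /h; move: nv; rewrite /dotz/=; lia.
have hl : h <= 2 * l by have := HG _ _ nl _ zin; rewrite /h; lia.
(* Bezout completes [n] to the unimodular matrix with rows [n] and [(- b, a)]. *)
have [a [b ab]] := Bezoutz n.1 n.2; rewrite (eqP cop) in ab.
have abR : a%:~R * n.1%:~R + b%:~R * n.2%:~R = 1 :> R.
  by have := congr1 (fun i : int => i%:~R : R) ab; rewrite /= rmorphD !rmorphM.
have Qle m c : (forall v, v \in s -> dotz m v <= c) ->
    forall y, Q' y -> m.1%:~R * y.1 + m.2%:~R * y.2 <= c%:~R :> R.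
  move=> mc y Qy; apply: (hull_pairing_le (u := lattice_pt R m)) Qy => v vin.
  by rewrite pairing_lattice_pt ler_int mc.
have in_Q v : v \in s -> Q' (lattice_pt R v) by exact: lattice_pt_in_hull.
apply: (@Vol_bound_coordinates R Q' n.1%:~R n.2%:~R (- b%:~R) a%:~R k l h
    (- b%:~R * v0.1%:~R + a%:~R * v0.2%:~R) (- b%:~R * z.1%:~R + a%:~R * z.2%:~R)) => //.
- by rewrite -[RHS]abR; ring.
- move=> v1 v2 v0'.
  (* The lattice vector whose new coordinates are [(v1, v2)]. *)
  pose w := (v1 * a - v2 * n.2, v1 * b + v2 * n.1).
  have w0 : w != 0.
    apply: contraTneq v0' => -[w1 w2].
    have e1 : v1 = n.1 * (v1 * a - v2 * n.2) + n.2 * (v1 * b + v2 * n.1).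
      by rewrite -[LHS]mulr1 -ab; ring.
    have e2 : v2 = a * (v1 * b + v2 * n.1) - b * (v1 * a - v2 * n.2).
      by rewrite -[LHS]mulr1 -ab; ring.
    by rewrite w1 w2 !mulr0 addr0 in e1; rewrite w1 w2 !mulr0 subr0 in e2; rewrite e1 e2.
  have [m [_ mw [l' [/andP[_ l'k] ml' _]]]] := facet_normal_exists Q0 kmax w0.
  (* The coefficients of [m] in the new coordinates: its values on the columns of the inverse
     matrix. *)
  exists (dotz m (a, b)), (dotz m (- n.2, n.1)); split.
    by move: mw; rewrite /w /dotz/=; lia.
  move=> _ [y Qy <-]; rewrite /lin_map/=.
  have -> : (dotz m (a, b))%:~R * (n.1%:~R * y.1 + n.2%:~R * y.2) +
      (dotz m (- n.2, n.1))%:~R * (- b%:~R * y.1 + a%:~R * y.2) =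
      (m.1%:~R * y.1 + m.2%:~R * y.2) * (a%:~R * n.1%:~R + b%:~R * n.2%:~R) :> R.
    by rewrite /dotz/= !(rmorphD, rmorphM, rmorphN)/=; ring.
  rewrite abR mulr1; apply: le_trans (Qle _ _ ml' _ Qy) _.
  by rewrite pmulrn ler_int.
- by exists (0, 0); [exact: interior_subset|rewrite /lin_map/= !mulr0 addr0].
- move=> _ [y Qy <-]; rewrite /lin_map/= (Qle _ _ nl _ Qy) andbT.
  have := Qle (- n.1, - n.2) h _ _ Qy; rewrite /= !rmorphN/=.
  have /[swap] /[apply] : forall v, v \in s -> dotz (- n.1, - n.2) v <= h.
    by move=> v /zmin; rewrite /h /dotz/=; lia.
  by lra.
- exists (lattice_pt R v0); first exact: in_Q.
  by rewrite /lin_map /= -nv0 /dotz rmorphD !rmorphM.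
- exists (lattice_pt R z); first exact: in_Q.
  by rewrite /lin_map /= /h /dotz rmorphN opprK rmorphD !rmorphM.
Qed.

Theorem corollary4p5 (R : realType) (Q : set (R * R)) (k : nat)
    (hQ : IP_polygon Q) (hm : is_max_local_index Q k) (hk : (2 <= k)%N) :
  [/\ (Vol Q <= (4 * k%:R ^+ 3 + 8 * k%:R ^+ 2)%:E)%E,
      LDP_polygon Q ->
        (Vol Q <= (4 * k%:R ^+ 3 + 8 * k%:R ^+ 2 - 2 * k%:R)%:E)%E
    & LDP_polygon Q -> (3 <= k)%N -> prime k ->
        (Vol Q <= (4 * k%:R ^+ 3 + 4 * k%:R ^+ 2 - 2 * k%:R)%:E)%E].
Proof.
have [V [VQ V2 V3]] := Vol_bound hQ hm hk.
split=> [|_|_ k3 _]; apply: le_trans VQ _; rewrite lee_fin.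
- by apply: le_trans V2 _; rewrite gerBl mulr_ge0.
- exact: V2.
- exact: V3.
Qed.
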